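(* Let $\Gamma\subset\mathbb{P}^9$ be a set of thirteen general points. Then there exists a $3$-Veronese surface containing $\Gamma$.
   Context: Work over an algebraically closed field of characteristic $0$. A $3$-Veronese surface in $\mathbb{P}^9$ is the image of $\mathbb{P}^2$ under an embedding by the complete linear system of plane cubics (the degree $9$ del Pezzo surface). *)

(* Defs.v *)
From HB Require Import structures.
From mathcomp Require Import all_boot all_order all_algebra.
From mathcomp Require Export mpoly.
Set Implicit Arguments. Unset Strict Implicit. Unset Printing Implicit Defensive.
Import GRing.Theory.
Local Open Scope ring_scope.

Definition cubic_exps : seq (nat * nat * nat) :=
  [:: (3,0,0); (2,1,0); (2,0,1); (1,2,0); (1,1,1); (1,0,2);
      (0,3,0); (0,2,1); (0,1,2); (0,0,3)]%N.

Definition cubic_mon (K : comRingType) (x : 'rV[K]_3) : 'rV[K]_10 :=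
  \row_(j < 10)
    let: (a, b, c) := nth (0,0,0)%N cubic_exps j in
    x 0 0 ^+ a * x 0 1 ^+ b * x 0 2 ^+ c.

(* The 3-Veronese surface in P^9 determined by an invertible matrix A, i.e.
   the image of P^2 under the standard Veronese embedding followed by the
   projective linear automorphism [A] of P^9 (every embedding by the complete
   linear system of cubics is of this form).  A nonzero vector v of K^10
   represents a point of this surface iff v is proportional to
   cubic_mon x *m A for some nonzero x in K^3. *)
Definition on_veronese3 (K : fieldType) (A : 'M[K]_10) (v : 'rV[K]_10) : Prop :=
  exists x : 'rV[K]_3, x != 0 /\ exists c : K, v = c *: (cubic_mon x *m A).

Definition is_veronese3_matrix (K : fieldType) (A : 'M[K]_10) : bool :=
  A \in unitmx.

(* Main.v *)
(* The configurations of points lying on a Veronese surface form the image of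
   (x_1, ..., x_13, A) |-> (cubic_mon x_i *m A)_i.  By quantifier elimination
   this image contains a nonempty open set as soon as it is Zariski dense, and
   it is dense if the map has surjective differential at one point.

   The base point is A = 1 and the 13 points p of P^2(F_3), lifted to
   coordinates in {-1, 0, 1}.  Taking second differences in each of the three
   variables shows that the linear relations between the cubic_mon p are
   spanned by the three relations with coefficients c(p) p_j,
   c(p) = (-2)^(number of zero coordinates of p): the points are their own Gale
   transform.  Hence a functional annihilating the image of the differential is
   given by three cubic forms f_j such that the cubics sum_j x_j df_j/dx_k vanish
   at all 13 points.  No nonzero cubic vanishes there, so with
   F = sum_j x_j f_j this reads f_k = dF/dx_k; then F = sum_k x_k f_k = 4 F by
   Euler's identity, so F = 0 and all f_k = 0 in characteristic zero. *)
Require Import Defs.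
From HB Require Import structures.
From mathcomp Require Import all_boot all_order all_algebra.
From mathcomp Require Import mpoly.
From mathcomp Require Import closed_field ring.
Import GRing.Theory.
Set Implicit Arguments. Unset Strict Implicit.
Local Open Scope ring_scope.

(** * Dense images contain open sets *)

(** Keeps distinct monomials apart under the Kronecker substitution below. *)
Lemma expand_base_inj n b (c d : 'I_n -> nat) :
  (forall i, c i < b)%N -> (forall i, d i < b)%N ->
  (\sum_i c i * b ^ i = \sum_i d i * b ^ i)%N -> c =1 d.
Proof.
elim: n c d => [|n IHn] c d cb db; first by move=> _ [].
rewrite !big_ord_recl !expn0 !muln1.
under eq_bigr do rewrite /= /bump add1n expnS mulnCA.
under [in RHS]eq_bigr do rewrite /= /bump add1n expnS mulnCA.
rewrite -!big_distrr /= => E.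
have b_gt0 : (0 < b)%N by apply: leq_ltn_trans (cb ord0).
have E0 : c ord0 = d ord0.
  have := congr1 (modn^~ b) E.
  by rewrite /= addnC mulnC modnMDl modn_small // addnC mulnC modnMDl modn_small.
have E1 : (fun i => c (lift ord0 i)) =1 (fun i => d (lift ord0 i)).
  apply: IHn => // ; move: E; rewrite E0 => /addnI /eqP.
  by rewrite eqn_pmul2l // => /eqP.
by move=> i; case: (unliftP ord0 i) => [j ->|->].
Qed.

(* Kronecker substitution 'X_i |-> 'X^(b ^ i), where b exceeds every exponent. *)
Lemma mpoly_nonroot (K : closedFieldType) n (p : {mpoly K[n]}) :
  p != 0 -> exists v : 'I_n -> K, p.@[v] != 0.
Proof.
move=> p0; pose b := (msize p).+1.
pose e (m : 'X_{1..n}) := (\sum_(i < n) m i * b ^ i)%N.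
have e_inj : {in msupp p &, injective e}.
  move=> m1 m2 m1p m2p E; apply/mnmP => i.
  have bnd m : m \in msupp p -> forall j, (m j < b)%N.
    move=> mp j; have /ltnW := msize_mdeg_lt mp; rewrite ltnS; apply: leq_trans.
    by rewrite mdegE (bigD1 j) //= leq_addr.
  exact: (expand_base_inj (bnd _ m1p) (bnd _ m2p) E).
pose q : {poly K} := \sum_(m <- msupp p) p@_m *: 'X^(e m).
have /closed_nonrootP [x qx] : q != 0.
  have [m mp] : exists m, m \in msupp p.
    by move: p0; rewrite -msupp_eq0; case: (msupp p) => // m s _; exists m; rewrite mem_head.
  apply: contraTneq mp => q0; rewrite mcoeff_msupp negbK.
  have := congr1 (fun r : {poly K} => r`_(e m)) q0; rewrite /q coef_sum coef0.
  case mp: (m \in msupp p); last by move: mp; rewrite mcoeff_msupp => /negbFE.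
  rewrite (bigD1_seq m) //= coefZ coefXn eqxx mulr1 big_seq_cond.
  rewrite big1 ?addr0 => [->//|m' /andP[m'p neq]].
  rewrite coefZ coefXn; case: eqP => [/e_inj E|]; last by rewrite mulr0.
  by rewrite E ?eqxx in neq.
exists (fun i => x ^+ (b ^ i)); rewrite mevalE.
move: qx; rewrite rootE; congr (_ != 0); rewrite /q horner_sum.
apply: eq_bigr => m _; rewrite hornerZ hornerXn /e expr_sum; congr (_ * _).
by apply: eq_bigr => i _; rewrite -exprM mulnC.
Qed.

Lemma nth_codom_ord (T : Type) (x0 : T) n (y : 'I_n -> T) (i : 'I_n) :
  nth x0 (codom y) i = y i.
Proof. by rewrite codomE (nth_map i) ?size_enum_ord // nth_ord_enum. Qed.

Section DenseConstructible.
Variable (K : closedFieldType).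
Implicit Types (t : GRing.term K) (f : GRing.formula K).

Lemma mpoly_of_term n t : GRing.rterm t ->
  exists p : {mpoly K[n]}, forall y, GRing.eval (codom y) t = p.@[y].
Proof.
elim: t => //=.
- move=> i _; case: (ltnP i n) => [lt_in|le_ni].
    exists 'X_(Ordinal lt_in) => y; rewrite mevalXU.
    exact: (nth_codom_ord 0 y (Ordinal lt_in)).
  exists 0 => y; rewrite meval0 nth_default //.
  by rewrite size_codom card_ord.
- by move=> x _; exists x%:MP => y; rewrite mevalC.
- by move=> k _; exists k%:R => y; rewrite rmorph_nat.
- by move=> t1 I1 t2 I2 /andP[/I1[p1 E1] /I2[p2 E2]]; exists (p1 + p2) => y; rewrite mevalD E1 E2.
- by move=> t1 I1 /I1[p1 E1]; exists (- p1) => y; rewrite mevalN E1.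
- by move=> t1 I1 k /I1[p1 E1]; exists (p1 *+ k) => y; rewrite mevalMn E1.
- by move=> t1 I1 t2 I2 /andP[/I1[p1 E1] /I2[p2 E2]]; exists (p1 * p2) => y; rewrite mevalM E1 E2.
- by move=> t1 I1 k /I1[p1 E1]; exists (p1 ^+ k) => y; rewrite rmorphXn /= E1.
Qed.

(** An equation between distinct polynomials fails off the zero set of their difference; [F] is a
    product of such differences. *)
Lemma qf_eval_generic n f : GRing.qf_form f -> GRing.rformula f ->
  exists (F : {mpoly K[n]}) (b : bool), F != 0 /\
    forall y, F.@[y] != 0 -> GRing.qf_eval (codom y) f = b.
Proof.
have combine f1 f2 (op : bool -> bool -> bool) :
    (exists (F : {mpoly K[n]}) (b : bool), F != 0 /\
      forall y, F.@[y] != 0 -> GRing.qf_eval (codom y) f1 = b) ->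
    (exists (F : {mpoly K[n]}) (b : bool), F != 0 /\
      forall y, F.@[y] != 0 -> GRing.qf_eval (codom y) f2 = b) ->
    exists (F : {mpoly K[n]}) (b : bool), F != 0 /\
      forall y, F.@[y] != 0 ->
        op (GRing.qf_eval (codom y) f1) (GRing.qf_eval (codom y) f2) = b.
  move=> [F1 [b1 [F10 E1]]] [F2 [b2 [F20 E2]]].
  exists (F1 * F2), (op b1 b2); split=> [|y]; first by rewrite mulf_neq0.
  by rewrite mevalM mulf_eq0 negb_or => /andP[/E1-> /E2->].
elim: f => //=.
- by move=> b _ _; exists 1, b; split; rewrite ?oner_neq0.
- move=> t1 t2 _ /andP[/(mpoly_of_term n)[p1 E1] /(mpoly_of_term n)[p2 E2]].
  have [p12|p12] := eqVneq p1 p2.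
    by exists 1, true; split=> [|y _]; rewrite ?oner_neq0 // E1 E2 p12 eqxx.
  exists (p1 - p2), false; split=> [|y]; first by rewrite subr_eq0.
  by rewrite mevalB subr_eq0 E1 E2 => /negbTE.
- move=> f1 I1 f2 I2 /andP[q1 q2] /andP[r1 r2].
  by apply: (combine f1 f2 andb); [apply: I1 | apply: I2].
- move=> f1 I1 f2 I2 /andP[q1 q2] /andP[r1 r2].
  by apply: (combine f1 f2 orb); [apply: I1 | apply: I2].
- move=> f1 I1 f2 I2 /andP[q1 q2] /andP[r1 r2].
  by apply: (combine f1 f2 implb); [apply: I1 | apply: I2].
- move=> f1 I1 q1 r1.
  (* Negation is handled as a binary connective that ignores its second argument. *)
  by apply: (combine f1 f1 (fun b _ => ~~ b)); apply: I1.
Qed.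

(* Quantifier elimination makes f a Boolean combination of polynomial
   equations, so its truth value is constant off a hypersurface. *)
Lemma dense_definable_open n f :
  (forall G : {mpoly K[n]}, G != 0 ->
     exists y, GRing.holds (codom y) f /\ G.@[y] != 0) ->
  exists F : {mpoly K[n]}, F != 0 /\
    forall y, F.@[y] != 0 -> GRing.holds (codom y) f.
Proof.
move=> dense; have closedK := @solve_monicpoly K.
pose qe := GRing.quantifier_elim (@ClosedFieldQE.ex_elim K).
have wfK := @ClosedFieldQE.wf_ex_elim K.
have rf := GRing.to_rform_rformula f.
have /andP[qf rqf] := GRing.quantifier_elim_wf wfK rf.
have holdsE e : GRing.holds e f <-> GRing.qf_eval e (qe (GRing.to_rform f)).
  have P := GRing.quantifier_elim_rformP wfK (ClosedFieldQE.holds_ex_elim closedK) e rf.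
  by split=> [/GRing.to_rformP /P | /P /GRing.to_rformP].
have [F [b [F0 EF]]] := qf_eval_generic n qf rqf.
exists F; split=> // y Fy; apply/holdsE; rewrite EF //.
(* Density gives a point [z] off the hypersurface where [f] holds, so the generic truth value is
   true. *)
by have [z [/holdsE zf Fz]] := dense F F0; rewrite -(EF z).
Qed.

(** The quantified variables are numbered right after the free ones, so each assignment just appends
    to the environment. *)
Lemma holds_exists_iota f (e : seq K) k :
  GRing.holds e (foldr GRing.Exists f (iota (size e) k)) <->
  exists t : 'I_k -> K, GRing.holds (e ++ codom t) f.
Proof.
elim: k e => [|k IHk] e /=.
  have codom0 (t : 'I_0 -> K) : codom t = [::] by apply: size0nil; rewrite size_codom card_ord.
  split=> [ef|[t]]; last by rewrite codom0 cats0.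
  by exists (fun=> 0); rewrite codom0 cats0.
have setE x : set_nth 0 e (size e) x = rcons e x.
  by rewrite set_nthE ltnn subnn /= -cats1.
have codomS (t : 'I_k.+1 -> K) : codom t = t ord0 :: codom (fun i => t (lift ord0 i)).
  by rewrite !codomE enum_ordSl /= -map_comp.
split=> [[x]|[t]].
  rewrite setE -(size_rcons e x) => /IHk[t ef].
  exists (fun i => if unlift ord0 i is Some j then t j else x).
  rewrite codomS unlift_none -cat_rcons; congr (GRing.holds (_ ++ _) f): ef.
  by apply: eq_codom => i; rewrite liftK.
rewrite codomS -cat_rcons => ef; exists (t ord0).
by rewrite setE -(size_rcons e (t ord0)); apply/IHk; exists (fun i => t (lift ord0 i)).
Qed.

Definition term_of_mpoly (k n : nat) (p : {mpoly K[n]}) : GRing.term K :=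
  foldr (fun m s => GRing.Add (GRing.Mul (GRing.Const p@_m)
     (foldr (fun (i : 'I_n) u => GRing.Mul (GRing.Exp (GRing.Var K (k + i)) (m i)) u)
        (GRing.Const 1) (enum 'I_n))) s) (GRing.Const 0) (msupp p).

Lemma eval_term_of_mpoly n (p : {mpoly K[n]}) (e : seq K) (t : 'I_n -> K) :
  GRing.eval (e ++ codom t) (term_of_mpoly (size e) p) = p.@[t].
Proof.
rewrite mevalE /term_of_mpoly; elim: (msupp p) => [|m s IHs] /=; first by rewrite big_nil.
rewrite big_cons IHs; congr (_ * _ + _).
rewrite -big_enum /=; elim: (enum 'I_n) => [|i r IHr] /=; first by rewrite big_nil.
rewrite big_cons IHr; congr (_ ^+ _ * _).
rewrite nth_cat ltnNge leq_addr /= addKn.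
exact: nth_codom_ord.
Qed.

(** The image of the open set [D] <> 0 is defined by an existential formula, hence definable. With
    [D] a determinant this keeps the matrix invertible. *)
Lemma dense_image_open n k (phi : 'I_n -> {mpoly K[k]}) (D : {mpoly K[k]}) :
  (forall G : {mpoly K[n]}, G != 0 ->
     exists t : 'I_k -> K, D.@[t] != 0 /\ G.@[fun j => (phi j).@[t]] != 0) ->
  exists F : {mpoly K[n]}, F != 0 /\
    forall y, F.@[y] != 0 ->
      exists t : 'I_k -> K, D.@[t] != 0 /\ forall j, (phi j).@[t] = y j.
Proof.
move=> dense.
pose body := foldr GRing.And
  (GRing.Not (GRing.Equal (term_of_mpoly n D) (GRing.Const 0)))
  [seq GRing.Equal (term_of_mpoly n (phi j)) (GRing.Var K j) | j <- enum 'I_n].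
have bodyP (y : 'I_n -> K) (t : 'I_k -> K) : GRing.holds (codom y ++ codom t) body <->
    D.@[t] != 0 /\ forall j, (phi j).@[t] = y j.
  have sz : size (codom y) = n by rewrite size_codom card_ord.
  have evD (p : {mpoly K[k]}) : GRing.eval (codom y ++ codom t) (term_of_mpoly n p) = p.@[t].
    by rewrite -{2}sz eval_term_of_mpoly.
  have evy (j : 'I_n) : (codom y ++ codom t)`_j = y j.
    rewrite nth_cat sz ltn_ord.
    exact: nth_codom_ord.
  suff -> : GRing.holds (codom y ++ codom t) body <->
    D.@[t] != 0 /\ forall j, j \in enum 'I_n -> (phi j).@[t] = y j.
    by split=> -[? E]; split=> // j; rewrite E // mem_enum.
  rewrite /body; elim: (enum 'I_n) => [|j s IHs] /=.
    by rewrite evD; split=> [/eqP|[/eqP]].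
  rewrite evD evy IHs; split=> [[Ej [? E]]|[? E]].
    by split=> // i; rewrite inE => /predU1P[->|/E].
  by split; [apply: E; rewrite mem_head | split=> // i si; apply: E; rewrite inE si orbT].
pose f := foldr GRing.Exists body (iota n k).
have fP (y : 'I_n -> K) : GRing.holds (codom y) f <->
    exists t : 'I_k -> K, D.@[t] != 0 /\ forall j, (phi j).@[t] = y j.
  have sz : size (codom y) = n by rewrite size_codom card_ord.
  have -> : f = foldr GRing.Exists body (iota (size (codom y)) k) by rewrite sz.
  by rewrite holds_exists_iota; split=> -[t /bodyP ?]; exists t.
have [|F [F0 EF]] := @dense_definable_open n f; last first.
  by exists F; split=> // y /EF/fP.
move=> G /dense[t [Dt Gt]]; exists (fun j => (phi j).@[t]); split=> //.
by apply/fP; exists t.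
Qed.

End DenseConstructible.

(** * Density from first-order deformations *)

(* If m is a monomial of G(y0 + .) of least degree d and v a point where the
   degree d part does not vanish, then G has order exactly d along a curve
   through y0 with velocity v. *)
Lemma all_velocities_dense (K : closedFieldType) n (S : ('I_n -> K) -> Prop)
    (y0 : 'I_n -> K) :
  (forall v : 'I_n -> K, exists (gamma : 'I_n -> {poly K}) (d : {poly K}),
     [/\ d != 0,
         forall j, (gamma j).[0] = y0 j,
         forall j, (gamma j)^`().[0] = v j
       & forall s, d.[s] != 0 -> S (fun j => (gamma j).[s])]) ->
  forall G : {mpoly K[n]}, G != 0 -> exists y, S y /\ G.@[y] != 0.
Proof.
move=> curves G G0.
pose H := G \mPo [tuple 'X_j + (y0 j)%:MP | j < n].
have HE y : H.@[y] = G.@[fun j => y j + y0 j].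
  rewrite comp_mpoly_meval; apply: meval_eq => j.
  by rewrite tnth_mktuple mevalD mevalXU mevalC.
have H0 : H != 0.
  have [y Gy] := mpoly_nonroot G0.
  have : H.@[fun j => y j - y0 j] != 0.
    by rewrite HE; congr (_ != 0): Gy; apply: meval_eq => j; rewrite subrK.
  by apply: contraNneq => ->; rewrite meval0.
have [d [m0 [m0H dE]] dmin] : exists2 d, exists m, m \in msupp H /\ mdeg m = d
    & forall m, m \in msupp H -> (d <= mdeg m)%N.
  have ex : exists d, has (fun m => mdeg m == d) (msupp H).
    move: H0; rewrite -msupp_eq0; case: (msupp H) => // m s _.
    by exists (mdeg m); rewrite /= eqxx.
  case: (ex_minnP ex) => d /hasP[m mH /eqP dE] dmin.
  by exists d => [|m' m'H]; [exists m | apply: dmin; apply/hasP; exists m'].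
pose L : {mpoly K[n]} := \sum_(m <- msupp H | mdeg m == d) H@_m *: 'X_[m].
have [v Lv] : exists v : 'I_n -> K, L.@[v] != 0.
  apply: mpoly_nonroot; apply: contraTneq m0H => L0; rewrite mcoeff_msupp negbK.
  have := congr1 (mcoeff m0) L0; rewrite /L raddf_sum mcoeff0 /=.
  case m0H: (m0 \in msupp H); last by move: m0H; rewrite mcoeff_msupp => /negbFE.
  rewrite -big_filter (bigD1_seq m0) ?filter_uniq ?msupp_uniq ?mem_filter ?dE ?eqxx //=.
  rewrite mcoeffZ mcoeffX eqxx mulr1 big1 ?addr0 => [->//|m neq].
  by rewrite mcoeffZ mcoeffX (negbTE neq) mulr0.
have [gamma [c [c0 g0 g1 gS]]] := curves v.
have /fin_all_exists[delta deltaE] j : exists q, gamma j = q * 'X + (y0 j)%:P.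
  have /factor_theorem[q qE] : root (gamma j - (y0 j)%:P) 0.
    by rewrite rootE hornerE hornerN hornerC g0 subrr.
  by exists q; rewrite -[LHS](subrK (y0 j)%:P) qE subr0.
have delta0 j : (delta j).[0] = v j.
  by rewrite -g1 deltaE derivD derivC derivM derivX addr0 !hornerE ?mulr0 ?add0r.
(* [q] is H([gamma] - [y0]) divided by 'X^d; only the degree [d] part of [H] survives at 0, so its
   value there is L(v). *)
pose q : {poly K} :=
  \sum_(m <- msupp H) (H@_m)%:P * 'X^(mdeg m - d) * \prod_j delta j ^+ m j.
have q0 : q.[0] != 0.
  congr (_ != 0): Lv; rewrite /L /q raddf_sum horner_sum /= big_mkcond /= big_seq [RHS]big_seq.
  apply: eq_bigr => m mH; rewrite !hornerM hornerC hornerXn horner_prod.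
  have -> : \prod_j (delta j ^+ m j).[0] = \prod_j v j ^+ m j.
    by apply: eq_bigr => j _; rewrite horner_exp delta0.
  rewrite expr0n subn_eq0 eqn_leq dmin // andbT mevalZ mevalX.
  by case: leqP => _; rewrite ?mulr1 // mulr0 mul0r.
have HgE s : H.@[fun j => (gamma j).[s] - y0 j] = s ^+ d * q.[s].
  rewrite mevalE /q horner_sum mulr_sumr big_seq [RHS]big_seq.
  apply: eq_bigr => m mH; rewrite !hornerM hornerC hornerXn horner_prod.
  rewrite mulrA [s ^+ d * _]mulrCA -exprD subnKC ?dmin // -mulrA; congr (_ * _).
  rewrite mdegE expr_sum -big_split /=; apply: eq_bigr => j _.
  by rewrite deltaE horner_exp -exprMn !hornerE addrK mulrC.
have /closed_nonrootP[s] : 'X * (q * c) != 0.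
  rewrite !mulf_neq0 ?polyX_eq0 //; apply: contraNneq q0 => ->.
  by rewrite horner0.
rewrite rootE !hornerM hornerX !mulf_eq0 !negb_or => /and3P[s0 qs cs].
exists (fun j => (gamma j).[s]); split; first exact: gS.
have : H.@[fun j => (gamma j).[s] - y0 j] != 0 by rewrite HgE mulf_neq0 ?expf_neq0.
by rewrite HE; congr (_ != 0); apply: meval_eq => j; rewrite subrK.
Qed.

(** * The points of P^2(F_3) and their relations *)

Lemma all_iota2 m n (P : nat -> nat -> bool) :
  all (fun i => all (P i) (iota 0 n)) (iota 0 m) ->
  forall (i : 'I_m) (j : 'I_n), P i j.
Proof.
move=> /allP Pmn i j; have := Pmn i.
rewrite mem_iota ltn_ord => /(_ isT)/allP/(_ j).
by rewrite mem_iota ltn_ord => /(_ isT).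
Qed.

Section IntegerMatrices.
Variable R : pzRingType.

(** Entries are integer functions on [nat], so that matrix identities over any ring reduce to closed
    computations in [int]. *)
Definition mx_of_int m n (f : nat -> nat -> int) : 'M[R]_(m, n) :=
  \matrix_(i, j) (f i j)%:~R.

Lemma eq_mx_of_int m n (f g : nat -> nat -> int) :
  all (fun i => all (fun j => f i j == g i j) (iota 0 n)) (iota 0 m) ->
  mx_of_int m n f = mx_of_int m n g.
Proof. by move=> /all_iota2 fg; apply/matrixP => i j; rewrite !mxE (eqP (fg i j)). Qed.

Definition sum_upto n (F : nat -> int) : int := foldr (fun k s => F k + s) 0 (iota 0 n).

Lemma intr_sum_upto n (F : nat -> int) :
  (sum_upto n F)%:~R = \sum_(k < n) (F k)%:~R :> R.
Proof.
rewrite -(big_mkord xpredT (fun k => (F k)%:~R)) /index_iota subn0 /sum_upto.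
elim: (iota 0 n) => [|k s IHs] /=; first by rewrite big_nil.
by rewrite big_cons rmorphD /= IHs.
Qed.

Lemma mul_mx_of_int m n p (f g : nat -> nat -> int) :
  mx_of_int m n f *m mx_of_int n p g =
  mx_of_int m p (fun i j => sum_upto n (fun k => f i k * g k j)).
Proof.
apply/matrixP => i j; rewrite !mxE intr_sum_upto; apply: eq_bigr => k _.
by rewrite !mxE rmorphM.
Qed.

Lemma add_mx_of_int m n (f g : nat -> nat -> int) :
  mx_of_int m n f + mx_of_int m n g = mx_of_int m n (fun i j => f i j + g i j).
Proof. by apply/matrixP => i j; rewrite !mxE rmorphD. Qed.

Lemma scalar_mx_of_int n (a : nat) :
  a%:R%:M = mx_of_int n n (fun i j => if i == j then a%:Z else 0).
Proof. by apply/matrixP => i j; rewrite !mxE -val_eqE; case: eqP. Qed.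

End IntegerMatrices.

Definition cubic_exp (j k : nat) : nat :=
  let: (a, b, c) := nth (0, 0, 0)%N cubic_exps j in nth 0%N [:: a; b; c] k.

Definition base_points : seq (seq int) :=
  [:: [:: 1; 0; 0]; [:: 0; 1; 0]; [:: 0; 0; 1];
      [:: 0; 1; 1]; [:: 0; 1; -1]; [:: 1; 0; 1]; [:: 1; 0; -1];
      [:: 1; 1; 0]; [:: 1; -1; 0];
      [:: 1; 1; 1]; [:: 1; 1; -1]; [:: 1; -1; 1]; [:: 1; -1; -1]].

Definition base_coord (p k : nat) : int := nth 0 (nth [::] base_points p) k.

Definition base_cubic (p j : nat) : int :=
  base_coord p 0 ^+ cubic_exp j 0 * base_coord p 1 ^+ cubic_exp j 1
    * base_coord p 2 ^+ cubic_exp j 2.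

(** The partial derivative in x_k of the [j]-th cubic monomial at the point [p]. Where the
    subtraction truncates, the leading factor is 0. *)
Definition base_jac (k p j : nat) : int :=
  (cubic_exp j k)%:Z *
    (base_coord p 0 ^+ (cubic_exp j 0 - (k == 0))
     * base_coord p 1 ^+ (cubic_exp j 1 - (k == 1))
     * base_coord p 2 ^+ (cubic_exp j 2 - (k == 2))).

(* Coefficient of the second difference f(1) - 2 f(0) + f(-1) in each variable. *)
Definition base_weight (p : nat) : int :=
  (- 2) ^+ count_mem 0 (nth [::] base_points p).

Definition base_relation (j p : nat) : int := base_weight p * base_coord p j.

(** Places K^3 on the three coordinate points, which come first in [base_points]. *)
Definition coordinate_point (p j : nat) : int := if p == j then 1 else 0.

(* Row i gives four times the i-th coefficient of a cubic in terms of its values;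
   the ten base points other than the coordinate points already determine it. *)
Definition cubic_interp (i p : nat) : int :=
  nth 0 (nth [::]
   [:: [:: 0; 0; 0; 0; 0; 2; 2; 2; 2; -1; -1; -1; -1];
       [:: 0; 0; 0; -2; -2; 0; 0; 0; 0; 1; 1; -1; -1];
       [:: 0; 0; 0; -2; 2; 0; 0; 0; 0; 1; -1; 1; -1];
       [:: 0; 0; 0; 0; 0; -2; -2; 0; 0; 1; 1; 1; 1];
       [:: 0; 0; 0; 0; 0; 0; 0; 0; 0; 1; -1; -1; 1];
       [:: 0; 0; 0; 0; 0; 0; 0; -2; -2; 1; 1; 1; 1];
       [:: 0; 0; 0; 2; 2; 0; 0; 2; -2; -1; -1; 1; 1];
       [:: 0; 0; 0; 0; 0; -2; 2; 0; 0; 1; -1; 1; -1];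
       [:: 0; 0; 0; 0; 0; 0; 0; -2; 2; 1; 1; -1; -1];
       [:: 0; 0; 0; 2; -2; 2; -2; 0; 0; -1; 1; -1; 1]] i) p.

(* Right multiplication of cubic_mon x by this matrix applies x_j d/dx_k to each
   monomial. *)
Definition cubic_gl (j k i m : nat) : int :=
  if all (fun l => cubic_exp i l + (l == k) == cubic_exp m l + (l == j))%N (iota 0 3)
  then (cubic_exp m k)%:Z else 0.

Lemma cubic_interpK (R : pzRingType) :
  mx_of_int R 10 13 cubic_interp *m mx_of_int R 13 10 base_cubic = 4%:R%:M.
Proof.
rewrite mul_mx_of_int scalar_mx_of_int; apply: eq_mx_of_int.
by vm_compute.
Qed.

(** A splitting of the evaluation map: once 4 is inverted, any vector killed by the three relations
    is the value vector of a cubic. On the coordinate points the relations form 4 times the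
    identity. *)
Lemma base_relation_exact (R : pzRingType) :
  mx_of_int R 13 10 base_cubic *m mx_of_int R 10 13 cubic_interp
  + mx_of_int R 13 3 coordinate_point *m mx_of_int R 3 13 base_relation = 4%:R%:M.
Proof.
rewrite !mul_mx_of_int add_mx_of_int scalar_mx_of_int; apply: eq_mx_of_int.
by vm_compute.
Qed.

Lemma cubic_gl_base (R : pzRingType) (j k : 'I_3) :
  mx_of_int R 13 10 base_cubic *m mx_of_int R 10 10 (cubic_gl j k) =
  mx_of_int R 13 10 (fun p m => base_coord p j * base_jac k p m).
Proof.
rewrite mul_mx_of_int; apply: eq_mx_of_int.
case: (nat_of_ord j) (ltn_ord j) => [|[|[|n]]] lt3; last by discriminate lt3.
all: case: (nat_of_ord k) (ltn_ord k) => [|[|[|n]]] {}lt3; last by discriminate lt3.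
all: by vm_compute.
Qed.

(* Euler's identity for the quadrics d f / d x_k, composed with x_j. *)
Lemma cubic_gl_euler (R : pzRingType) (j k : 'I_3) :
  \sum_(l < 3) mx_of_int R 10 10 (cubic_gl l k) *m mx_of_int R 10 10 (cubic_gl j l) =
  (3 * (j == k :> nat))%:R%:M + 2 *: mx_of_int R 10 10 (cubic_gl j k).
Proof.
rewrite !big_ord_recr big_ord0 /= add0r scaler_nat mulr2n scalar_mx_of_int.
rewrite !mul_mx_of_int !add_mx_of_int; apply: eq_mx_of_int.
case: (nat_of_ord j) (ltn_ord j) => [|[|[|n]]] lt3; last by discriminate lt3.
all: case: (nat_of_ord k) (ltn_ord k) => [|[|[|n]]] {}lt3; last by discriminate lt3.
all: by vm_compute.
Qed.

(* Modulo the A' part only the three relations r_j between the rows of w matter,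
   and the base points reduce them to solving sum_k s_k (x_j d/dx_k) = r_j for
   functionals s_k on cubics; s_k is found by dualising
   f_k = dF/dx_k - g_k, F = (sum_k x_k g_k) / 3, which solves
   sum_j x_j df_j/dx_k = g_k. *)
Lemma base_tangent_surj (K : fieldType) (hchar : [pchar K] =i pred0)
    (w : 'M[K]_(13, 10)) :
  exists (x' : 'M[K]_(13, 3)) (A' : 'M[K]_10),
    w = mx_of_int K 13 10 base_cubic *m A'
        + \matrix_(p, m) \sum_(k < 3) x' p k * (base_jac k p m)%:~R.
Proof.
have nat0 n : (n.+1%:R : K) != 0 by rewrite ((pcharf0P K).1 hchar).
set V := mx_of_int K 13 10 base_cubic.
pose W := mx_of_int K 10 13 cubic_interp.
pose R := mx_of_int K 3 13 base_relation.
pose E j k := mx_of_int K 10 10 (cubic_gl j k).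
pose c p : K := (base_weight p)%:~R.
have c0 p : c p != 0.
  by rewrite /c rmorphXn expf_neq0 // rmorphN oppr_eq0 (nat0 1%N).
pose r j := row j (R *m w).
(* The coefficient -2/3 is 1/3 - 1, since dF/dx_k = (g_k + sum_l x_l dg_l/dx_k) / 3. *)
pose s (l : 'I_3) := 3^-1 *: (\sum_(k < 3) r k *m E l k) - (2 / 3) *: r l.
have sE (j : 'I_3) : \sum_(k < 3) s k *m E j k = r j.
  have -> : \sum_(k < 3) s k *m E j k =
      3^-1 *: (\sum_(l < 3) r l *m \sum_(k < 3) E k l *m E j k)
      - (2 / 3) *: \sum_(k < 3) r k *m E j k.
    under eq_bigr do rewrite mulmxBl -!scalemxAl mulmx_suml.
    rewrite sumrB -!scaler_sumr exchange_big /=; congr (_ *: _ - _).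
    apply: eq_bigr => l _; rewrite mulmx_sumr.
    by apply: eq_bigr => k _; rewrite mulmxA.
  under eq_bigr do rewrite cubic_gl_euler mulmxDr mul_mx_scalar -scalemxAr.
  rewrite big_split /= (bigD1 j) //= eqxx big1 => [|l /negbTE lj].
    rewrite addr0 -scaler_sumr scalerDr !scalerA mulVf ?nat0 // scale1r.
    by rewrite [3^-1 * _]mulrC addrK.
  by rewrite eq_sym val_eqE lj muln0 scale0r.
(* The 4 cancels the one in [cubic_interpK], and [c p] cancels the weight in [base_relation]. *)
pose x' := \matrix_(p < 13, k < 3) ((s k *m W) 0 p / (4 * c p)).
pose D := \matrix_(p < 13, m < 10) \sum_(k < 3) x' p k * (base_jac k p m)%:~R.
have RD : R *m D = R *m w.
  apply/row_matrixP => j; rewrite -/(r j) -sE; apply/rowP => m.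
  rewrite summxE !mxE.
  transitivity (\sum_(p < 13) (base_relation j p)%:~R
      * \sum_(k < 3) x' p k * (base_jac k p m)%:~R).
    by apply: eq_bigr => p _; rewrite [R j p]mxE [D p m]mxE.
  under eq_bigr do rewrite mulr_sumr.
  rewrite exchange_big /=; apply: eq_bigr => k _.
  have -> : s k *m E j k = 4^-1 *: (s k *m W *m (V *m E j k)).
    rewrite mulmxA -(mulmxA (s k)) cubic_interpK mul_mx_scalar -scalemxAl scalerA.
    by rewrite mulVf ?nat0 // scale1r.
  rewrite cubic_gl_base !mxE mulr_sumr; apply: eq_bigr => p _.
  rewrite [x' p k]mxE [mx_of_int _ _ _ _ p m]mxE.
  rewrite (intrM _ (base_weight p)) (intrM _ (base_coord p j)) -/(c p).
  by move: ((s k *m W) 0 p) => y; field; rewrite c0 nat0.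
(* The relations kill what remains, so it consists of values of cubics, which the [A'] part
   supplies. *)
pose N := w - D.
have N4 : 4%:R *: N = V *m (W *m N).
  rewrite -mul_scalar_mx -base_relation_exact mulmxDl -!mulmxA -/R.
  by rewrite [R *m N]mulmxBr RD subrr mulmx0 addr0.
exists x', (4^-1 *: (W *m N)).
by rewrite -scalemxAr -N4 scalerA mulVf ?nat0 // scale1r subrK.
Qed.

(** * The parametrization of point configurations and its differential *)

Definition veronese_points (R : comNzRingType) n (x : 'M[R]_(n, 3)) (A : 'M[R]_10) :=
  \matrix_(i < n, j < 10) (cubic_mon (row i x) *m A) 0 j.

Lemma row_veronese_points (R : comNzRingType) n (x : 'M[R]_(n, 3)) (A : 'M[R]_10) i :
  row i (veronese_points x A) = cubic_mon (row i x) *m A.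
Proof. by apply/rowP => j; rewrite !mxE. Qed.

Lemma veronese_points_mul (R : comNzRingType) n (x : 'M[R]_(n, 3)) (A : 'M[R]_10) :
  veronese_points x A = veronese_points x 1%:M *m A.
Proof. by apply/row_matrixP => i; rewrite row_mul !row_veronese_points mulmx1. Qed.

(** Used both to specialize matrices of indeterminates and to evaluate curves of matrices at a
    parameter. *)
Lemma map_veronese_points (R S : comNzRingType) (f : {rmorphism R -> S}) n
    (x : 'M[R]_(n, 3)) (A : 'M[R]_10) :
  map_mx f (veronese_points x A) = veronese_points (map_mx f x) (map_mx f A).
Proof.
apply/matrixP => i j; rewrite !mxE rmorph_sum; apply: eq_bigr => k _.
rewrite rmorphM /= !mxE; congr (_ * _).
by case: nth => [[a b] c]; rewrite !rmorphM !rmorphXn /= ?mxE.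
Qed.

Lemma base_veronese_points (K : fieldType) :
  veronese_points (mx_of_int K 13 3 base_coord) 1%:M = mx_of_int K 13 10 base_cubic.
Proof.
apply/matrixP => p j; rewrite mxE mulmx1 !mxE /base_cubic /cubic_exp.
by case: nth => [[a b] c] /=; rewrite !rmorphM !rmorphXn /= ?mxE.
Qed.

Lemma cubic_mon_velocity (K : comNzRingType) (x v : 'rV[K]_3) (j : 'I_10) :
  (cubic_mon (map_mx polyC x + 'X *: map_mx polyC v) 0 j)^`().[0] =
  \sum_(k < 3) v 0 k * ((cubic_exp j k)%:R *
    (x 0 0 ^+ (cubic_exp j 0 - (k == 0 :> nat))
     * x 0 1 ^+ (cubic_exp j 1 - (k == 1 :> nat))
     * x 0 2 ^+ (cubic_exp j 2 - (k == 2 :> nat)))).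
Proof.
have derX n (y z : K) :
    (((y%:P + 'X * z%:P) ^+ n)^`()).[0] = z * (n%:R * y ^+ (n - 1)).
  rewrite deriv_exp derivD derivM derivC derivX derivC mulr0 addr0 mul1r add0r.
  by rewrite hornerMn hornerM horner_exp !hornerE subn1 -mulr_natr mulrAC.
have -> (F : 'I_3 -> K) : \sum_k F k = F 0 + F 1 + F 2.
  rewrite !big_ord_recl big_ord0 addr0 addrA.
  by congr (_ + F _ + F _); apply: val_inj.
rewrite !mxE /cubic_exp; case: nth => [[a b] c] /=.
rewrite !derivM ?mxE !(hornerD, hornerM) !derX !horner_exp !hornerD !hornerM !hornerC.
rewrite hornerX !mul0r !addr0 !subn0; ring.
Qed.

(** The product rule at A = 1: moving the matrix and moving the points contribute separately. *)
Lemma veronese_points_velocity (K : comNzRingType) n (x x' : 'M[K]_(n, 3)) (A' : 'M[K]_10) i j :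
  let P := veronese_points (map_mx polyC x + 'X *: map_mx polyC x')
             (1%:M + 'X *: map_mx polyC A') in
  (P i j)^`().[0] =
    (veronese_points x A') i j
    + (cubic_mon (map_mx polyC (row i x) + 'X *: map_mx polyC (row i x')) 0 j)^`().[0].
Proof.
set X := _ + _; move=> P.
have derE (u w : 'rV[{poly K}]_10) :
    ((u + 'X *: w) 0 j)^`().[0] = (u 0 j)^`().[0] + (w 0 j).[0].
  by rewrite !mxE derivD derivM derivX mul1r !hornerD hornerM hornerX mul0r addr0.
rewrite /P mxE mulmxDr mulmx1 -scalemxAr derE addrC; congr (_ + _); last first.
  congr (cubic_mon _ 0 j)^`().[0].
  by apply/rowP => k; rewrite !mxE.
have <- : map_mx (horner_eval 0) (veronese_points X (map_mx polyC A')) = veronese_points x A'.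
  rewrite map_veronese_points; congr veronese_points; apply/matrixP => k l.
    by rewrite /X !mxE /= /horner_eval hornerD hornerM hornerX mul0r addr0 hornerC.
  by rewrite !mxE /= /horner_eval hornerC.
by rewrite [RHS]mxE [in RHS]mxE.
Qed.

(** Guarantees that a nonzero row of [M] comes from a nonzero source point. *)
Lemma cubic_mon0 (K : comNzRingType) : cubic_mon (0 : 'rV[K]_3) = 0.
Proof.
apply/rowP => j; rewrite !mxE.
have /allP/(_ _ (mem_nth (0, 0, 0)%N _)) :
  all (fun e => let: (a, b, c) := e in (a + b + c)%N != 0) cubic_exps by [].
move=> /(_ j (ltn_ord j)); case: nth => [[a b] c].
by rewrite -!exprD expr0n => /negbTE ->.
Qed.

Unset Implicit Arguments.

(* Gamma = 13 points of P^9, given by the nonzero rows of a 13 x 10 matrix M.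
   "General" = outside a proper Zariski-closed subset: there is a nonzero
   polynomial F in the 130 coordinates of M such that the conclusion holds
   whenever F(M) <> 0. *)
Theorem theorem6p1 (K : closedFieldType) (hchar : [pchar K] =i pred0) :
  exists F : {mpoly K[13 * 10]},
    F != 0 /\
    forall M : 'M[K]_(13, 10),
      (forall i : 'I_13, row i M != 0) ->
      F.@[fun k => mxvec M 0 k] != 0 ->
      exists A : 'M[K]_10,
        is_veronese3_matrix A /\ forall i : 'I_13, on_veronese3 A (row i M).
Proof.
(* The parameters are the coordinates of the 13 source points followed by the entries of the
   matrix. *)
pose N := (13 * 3 + 10 * 10)%N.
pose Xg : 'M[{mpoly K[N]}]_(13, 3) := \matrix_(i, k) 'X_(lshift _ (mxvec_index i k)).
pose Ag : 'M[{mpoly K[N]}]_10 := \matrix_(i, k) 'X_(rshift _ (mxvec_index i k)).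
pose phi j := mxvec (veronese_points Xg Ag) 0 j.
have phiE t j : (phi j).@[t] =
    mxvec (veronese_points (map_mx (meval t) Xg) (map_mx (meval t) Ag)) 0 j.
  by rewrite -map_veronese_points -map_mxvec mxE.
have detE t : (\det Ag).@[t] = \det (map_mx (meval t) Ag) by rewrite det_map_mx.
have [|F [F0 FP]] := @dense_image_open K _ N phi (\det Ag); last first.
  exists F; split=> // M M0 /FP[t []]; rewrite detE => At phit.
  set x := map_mx (meval t) Xg in phit; set A := map_mx (meval t) Ag in At phit.
  have ME : veronese_points x A = M.
    by apply: (can_inj mxvecK); apply/rowP => j; rewrite -phit phiE.
  exists A; split=> [|i]; first by rewrite /is_veronese3_matrix unitmxE unitfE.
  have rowE : row i M = cubic_mon (row i x) *m A by rewrite -ME row_veronese_points.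
  exists (row i x); split; last by exists 1; rewrite scale1r.
  by apply: contraNneq (M0 i) => x0; rewrite rowE x0 cubic_mon0 mul0mx.
move=> G G0.
pose params (x : 'M[K]_(13, 3)) (A : 'M[K]_10) j := row_mx (mxvec x) (mxvec A) 0 j.
have paramX x A : map_mx (meval (params x A)) Xg = x.
  by apply/matrixP => i k; rewrite !mxE mevalXU /params row_mxEl mxvecE.
have paramA x A : map_mx (meval (params x A)) Ag = A.
  by apply/matrixP => i k; rewrite !mxE mevalXU /params row_mxEr mxvecE.
pose S (y : 'I_(13 * 10) -> K) :=
  exists t, (\det Ag).@[t] != 0 /\ forall j, (phi j).@[t] = y j.
have [|y [[t [At ty]] Gy]] :=
  @all_velocities_dense K _ S (fun j => mxvec (mx_of_int K 13 10 base_cubic) 0 j) _ G G0;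
  last first.
  by exists t; split=> //; congr (_ != 0): Gy; apply: meval_eq => j; rewrite ty.
move=> v; have [x' [A' wE]] := base_tangent_surj hchar (vec_mx (\row_j v j)).
pose x := mx_of_int K 13 3 base_coord.
(* The curve is the image of a line in parameter space through (x, 1) with direction (x', A'). Its
   bad parameters are the roots of [\det As], which equals 1 at 0. *)
pose Xs := map_mx polyC x + 'X *: map_mx polyC x'.
pose As : 'M[{poly K}]_10 := 1%:M + 'X *: map_mx polyC A'.
have evX s : map_mx (horner_eval s) Xs = x + s *: x'.
  by apply/matrixP => i k; rewrite !mxE /horner_eval !hornerE.
have evA s : map_mx (horner_eval s) As = 1%:M + s *: A'.
  by apply/matrixP => i k; rewrite !mxE /horner_eval !hornerE hornerMn hornerC.
have evP s j : (mxvec (veronese_points Xs As) 0 j).[s] =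
    mxvec (veronese_points (x + s *: x') (1%:M + s *: A')) 0 j.
  by rewrite -evX -evA -map_veronese_points -map_mxvec mxE.
exists (fun j => mxvec (veronese_points Xs As) 0 j), (\det As); split.
- have : (\det As).[0] != 0.
    by rewrite -[_.[0]]/(horner_eval 0 _) -det_map_mx evA scale0r addr0 det1 oner_neq0.
  by apply: contraNneq => ->; rewrite horner0.
- by move=> j; rewrite evP !scale0r !addr0 base_veronese_points.
- move=> j; case/mxvec_indexP: j => i k; rewrite mxvecE veronese_points_velocity.
  rewrite -[RHS]/(v _).
  have -> : v (mxvec_index i k) = vec_mx (\row_j v j) i k by rewrite !mxE.
  rewrite wE [RHS]mxE; congr (_ + _).
    by rewrite -base_veronese_points -veronese_points_mul.
  rewrite cubic_mon_velocity [RHS]mxE; apply: eq_bigr => l _; rewrite !mxE.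
  congr (_ * _); rewrite /base_jac !rmorphM !rmorphXn //=.
- move=> s ds; exists (params (x + s *: x') (1%:M + s *: A')); split.
    by rewrite detE paramA -evA det_map_mx.
  by move=> j; rewrite phiE paramX paramA evP.
Qed.
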